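(* Let $I\subset\mathbb{R}$ be an open interval containing $0$ and let $\vec\alpha:I\to E_1^4$ be a unit speed spacelike curve with spacelike principal normal, with Frenet frame $\{\vec T,\vec N,\vec B_1,\vec B_2\}$, with $\varepsilon=g(\vec B_1,\vec B_1)\in\{1,-1\}$, and with curvatures $\kappa_1(s),\kappa_2(s),\kappa_3(s)$ that are non-zero for every $s\in I$. Then $\vec\alpha$ is congruent to a rectifying spacelike curve if and only if there exist constants $A,B,c\in\mathbb{R}$ such that for all $s\in I$ $$\frac{\kappa_1(s)(s+c)}{\kappa_2(s)}=\varepsilon\Big(A\cosh\int_0^s\kappa_3(u)\,du+B\sinh\int_0^s\kappa_3(u)\,du\Big).$$
   Context: $E_1^4$ is $\mathbb{R}^4$ with the pseudo scalar product $g(\vec v,\vec w)=-v_1w_1+v_2w_2+v_3w_3+v_4w_4$. A vector $\vec v$ is spacelike if $g(\vec v,\vec v)>0$ or $\vec v=0$, timelike if $g(\vec v,\vec v)<0$. A (smooth) curve is spacelike if all its velocity vectors are spacelike (and non-zero), and a spacelike curve is unit speed if $g(\vec\alpha',\vec\alpha')=1$. A unit speed spacelike curve with spacelike principal normal is assumed to carry a smooth orthogonal Frenet frame $\{\vec T,\vec N,\vec B_1,\vec B_2\}$ (tangent, principal normal, first and second binormal) with $\vec T=\vec\alpha'$, $g(\vec T,\vec T)=g(\vec N,\vec N)=1$, $g(\vec B_1,\vec B_1)=-g(\vec B_2,\vec B_2)=\varepsilon=\pm1$, all other products zero, satisfying $$\vec T'=\kappa_1\vec N,\quad \vec N'=-\kappa_1\vec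 T+\kappa_2\vec B_1,\quad \vec B_1'=-\varepsilon\kappa_2\vec N+\kappa_3\vec B_2,\quad \vec B_2'=\kappa_3\vec B_1,$$ where the smooth functions $\kappa_1,\kappa_2,\kappa_3$ are the first, second and third curvatures. Such a curve is called rectifying if its position vector (with respect to the origin) always lies in the orthogonal complement of $\vec N$, i.e. $g(\vec\alpha(s),\vec N(s))=0$ for all $s$; equivalently $\vec\alpha=\lambda\vec T+\mu\vec B_1+\nu\vec B_2$ for some differentiable functions $\lambda,\mu,\nu$. Two curves are congruent if one is the image of the other under an isometry of $E_1^4$ (an affine map preserving $g$). *)

(* Defs.v *)
(* Real analysis on Stdlib's [R] with Coquelicot. *)
From Stdlib Require Import Reals.
From Coquelicot Require Import Coquelicot.
Open Scope R_scope.

(* R^4, as a nested product so that Coquelicot's vector-valued [is_derive]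
   and [is_linear] apply. *)
Definition E14 : NormedModule R_AbsRing :=
  prod_NormedModule R_AbsRing
    (prod_NormedModule R_AbsRing
      (prod_NormedModule R_AbsRing R_NormedModule R_NormedModule)
      R_NormedModule)
    R_NormedModule.

Definition x1 (v : E14) : R := fst (fst (fst v)).
Definition x2 (v : E14) : R := snd (fst (fst v)).
Definition x3 (v : E14) : R := snd (fst v).
Definition x4 (v : E14) : R := snd v.

Definition g (v w : E14) : R :=
  - x1 v * x1 w + x2 v * x2 w + x3 v * x3 w + x4 v * x4 w.

Definition spacelike (v : E14) : Prop := 0 < g v v \/ v = zero.

(* Bounded or unbounded: the endpoints may be infinite. *)
Definition Rbar_open_interval (a b : Rbar) (s : R) : Prop :=
  Rbar_lt a s /\ Rbar_lt s b.

(* Functions on an open set J are total functions of which only the values on J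
   matter. *)
Definition smooth_on (J : R -> Prop) (f : R -> R) : Prop :=
  forall (n : nat) (s : R), J s -> ex_derive_n f n s.

Definition smooth_curve_on (J : R -> Prop) (f : R -> E14) : Prop :=
  smooth_on J (fun s => x1 (f s)) /\ smooth_on J (fun s => x2 (f s)) /\
  smooth_on J (fun s => x3 (f s)) /\ smooth_on J (fun s => x4 (f s)).

Definition spacelike_curve (J : R -> Prop) (alpha : R -> E14) : Prop :=
  smooth_curve_on J alpha /\
  forall (s : R) (v : E14), J s -> is_derive alpha s v ->
    spacelike v /\ v <> zero.

Definition unit_speed_spacelike_curve (J : R -> Prop) (alpha : R -> E14) : Prop :=
  spacelike_curve J alpha /\
  forall (s : R) (v : E14), J s -> is_derive alpha s v -> g v v = 1.

Record frenet_frame (J : R -> Prop) (alpha : R -> E14) (eps : R)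
    (T N B1 B2 : R -> E14) (k1 k2 k3 : R -> R) : Prop := {
  frenet_eps : eps = 1 \/ eps = -1;
  frenet_smooth_T : smooth_curve_on J T;
  frenet_smooth_N : smooth_curve_on J N;
  frenet_smooth_B1 : smooth_curve_on J B1;
  frenet_smooth_B2 : smooth_curve_on J B2;
  frenet_smooth_k1 : smooth_on J k1;
  frenet_smooth_k2 : smooth_on J k2;
  frenet_smooth_k3 : smooth_on J k3;
  frenet_TT : forall s, J s -> g (T s) (T s) = 1;
  frenet_NN : forall s, J s -> g (N s) (N s) = 1;
  frenet_B1B1 : forall s, J s -> g (B1 s) (B1 s) = eps;
  frenet_B2B2 : forall s, J s -> g (B2 s) (B2 s) = - eps;
  frenet_TN : forall s, J s -> g (T s) (N s) = 0;
  frenet_TB1 : forall s, J s -> g (T s) (B1 s) = 0;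
  frenet_TB2 : forall s, J s -> g (T s) (B2 s) = 0;
  frenet_NB1 : forall s, J s -> g (N s) (B1 s) = 0;
  frenet_NB2 : forall s, J s -> g (N s) (B2 s) = 0;
  frenet_B1B2 : forall s, J s -> g (B1 s) (B2 s) = 0;
  frenet_alpha' : forall s, J s -> is_derive alpha s (T s);
  frenet_T' : forall s, J s -> is_derive T s (scal (k1 s) (N s));
  frenet_N' : forall s, J s ->
    is_derive N s (plus (scal (- k1 s) (T s)) (scal (k2 s) (B1 s)));
  frenet_B1' : forall s, J s ->
    is_derive B1 s (plus (scal (- eps * k2 s) (N s)) (scal (k3 s) (B2 s)));
  frenet_B2' : forall s, J s -> is_derive B2 s (scal (k3 s) (B1 s))
}.

(* The frame is existentially quantified: where k1 does not vanish, N is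
   determined up to sign by alpha, so the condition g(alpha, N) = 0 does not
   depend on the choice. *)
Definition rectifying (J : R -> Prop) (alpha : R -> E14) : Prop :=
  unit_speed_spacelike_curve J alpha /\
  exists (eps : R) (T N B1 B2 : R -> E14) (k1 k2 k3 : R -> R),
    frenet_frame J alpha eps T N B1 B2 k1 k2 k3 /\
    forall s, J s -> g (alpha s) (N s) = 0.

(* The boundedness clause of [is_linear] is automatic in finite dimension. *)
Definition isometry (F : E14 -> E14) : Prop :=
  exists (L : E14 -> E14) (p : E14),
    is_linear L /\
    (forall v w, g (L v) (L w) = g v w) /\
    forall v, F v = plus (L v) p.

Definition congruent (J : R -> Prop) (alpha beta : R -> E14) : Prop :=
  exists F : E14 -> E14, isometry F /\ forall s, J s -> beta s = F (alpha s).

(* Main.v *)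
(** Let f_X = g(beta, X) for X in the moving frame of beta. The Frenet equations
    give f_T' = 1 + k1 f_N, f_N' = - k1 f_T + k2 f_1, f_1' = - eps k2 f_N + k3 f_2
    and f_2' = k3 f_1. If f_N = 0, then f_T = s + c, so k1 (s + c) / k2 = f_1, and
    f_1' = k3 f_2, f_2' = k3 f_1 is the hyperbolic rotation system, whose first
    integrals are the constants of the theorem. Conversely, the
    formula for k1 (s + c) / k2 makes
    alpha - ((s + c) T + eps f_1 B1 - eps f_2 B2) constant, and translating alpha by
    this constant gives a rectifying curve. *)
Require Import Defs.
From Stdlib Require Import Reals Lra.
From Coquelicot Require Import Coquelicot.
Open Scope R_scope.

(** * Linear functionals and derivatives in [E14] *)

Lemma is_linear_x1 : is_linear x1.
Proof.
  apply (is_linear_comp (fun v : E14 => fst (fst v)) fst); [|apply is_linear_fst].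
  apply (is_linear_comp (fun v : E14 => fst v) fst); apply is_linear_fst.
Qed.

Lemma is_linear_x2 : is_linear x2.
Proof.
  apply (is_linear_comp (fun v : E14 => fst (fst v)) snd); [|apply is_linear_snd].
  apply (is_linear_comp (fun v : E14 => fst v) fst); apply is_linear_fst.
Qed.

Lemma is_linear_x3 : is_linear x3.
Proof.
  apply (is_linear_comp (fun v : E14 => fst v) snd);
    [apply is_linear_fst | apply is_linear_snd].
Qed.

Lemma is_linear_x4 : is_linear x4.
Proof. apply is_linear_snd. Qed.

Lemma E14_eq (v w : E14) :
  x1 v = x1 w -> x2 v = x2 w -> x3 v = x3 w -> x4 v = x4 w -> v = w.
Proof.
  destruct v as [[[v1 v2] v3] v4], w as [[[w1 w2] w3] w4].
  unfold x1, x2, x3, x4; simpl; congruence.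
Qed.

(** Chain rule with [L] as its own differential. It serves for the coordinates, for the linear part
    of an isometry and for arbitrary functionals. *)
Lemma is_derive_linear {U V : NormedModule R_AbsRing} (L : U -> V) (f : R -> U)
    (s : R) (v : U) :
  is_linear L -> is_derive f s v -> is_derive (fun t => L (f t)) s (L v).
Proof.
  intros HL Hf.
  apply (filterdiff_ext_lin _ (fun y : R_AbsRing => L (scal y v))).
  - apply (filterdiff_comp' f L s (fun y : R_AbsRing => scal y v) L Hf).
    now apply filterdiff_linear.
  - intros y; now apply linear_scal.
Qed.

(** Reduces to uniqueness of real derivatives, because the four coordinates are linear and separate
    points. *)
Lemma is_derive_E14_unique (f : R -> E14) (s : R) (v w : E14) :
  is_derive f s v -> is_derive f s w -> v = w.
Proof.
  intros Hv Hw.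
  assert (H : forall l : E14 -> R, is_linear l -> l v = l w).
  { intros l Hl.
    rewrite <- (is_derive_unique _ _ _ (is_derive_linear l f s v Hl Hv)).
    exact (is_derive_unique _ _ _ (is_derive_linear l f s w Hl Hw)). }
  apply E14_eq; apply H;
    auto using is_linear_x1, is_linear_x2, is_linear_x3, is_linear_x4.
Qed.

Lemma is_derive_Rplus (f h : R -> R) (s f' h' : R) :
  is_derive f s f' -> is_derive h s h' ->
  is_derive (fun t => f t + h t) s (f' + h').
Proof. exact (is_derive_plus f h s f' h'). Qed.

Lemma is_derive_Rmult (f h : R -> R) (s f' h' : R) :
  is_derive f s f' -> is_derive h s h' ->
  is_derive (fun t => f t * h t) s (f' * h s + f s * h').
Proof. intros Hf Hh; exact (is_derive_mult f h s f' h' Hf Hh Rmult_comm). Qed.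

Lemma is_derive_g (u v : R -> E14) (s : R) (u' v' : E14) :
  is_derive u s u' -> is_derive v s v' ->
  is_derive (fun t => g (u t) (v t)) s (g u' (v s) + g (u s) v').
Proof.
  intros Hu Hv.
  pose proof (is_derive_linear x1 u s u' is_linear_x1 Hu) as Hu1.
  pose proof (is_derive_linear x2 u s u' is_linear_x2 Hu) as Hu2.
  pose proof (is_derive_linear x3 u s u' is_linear_x3 Hu) as Hu3.
  pose proof (is_derive_linear x4 u s u' is_linear_x4 Hu) as Hu4.
  pose proof (is_derive_linear x1 v s v' is_linear_x1 Hv) as Hv1.
  pose proof (is_derive_linear x2 v s v' is_linear_x2 Hv) as Hv2.
  pose proof (is_derive_linear x3 v s v' is_linear_x3 Hv) as Hv3.
  pose proof (is_derive_linear x4 v s v' is_linear_x4 Hv) as Hv4.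
  unfold g.
  evar_last.
  - exact (is_derive_Rplus _ _ _ _ _ (is_derive_Rplus _ _ _ _ _ (is_derive_Rplus _ _ _ _ _
      (is_derive_Rmult _ _ _ _ _ (is_derive_opp _ _ _ Hu1) Hv1)
      (is_derive_Rmult _ _ _ _ _ Hu2 Hv2)) (is_derive_Rmult _ _ _ _ _ Hu3 Hv3))
      (is_derive_Rmult _ _ _ _ _ Hu4 Hv4)).
  - unfold opp; simpl; ring.
Qed.

Lemma g_plus_r (u v w : E14) : g u (plus v w) = g u v + g u w.
Proof.
  unfold g; change (x1 (plus v w)) with (x1 v + x1 w);
    change (x2 (plus v w)) with (x2 v + x2 w);
    change (x3 (plus v w)) with (x3 v + x3 w);
    change (x4 (plus v w)) with (x4 v + x4 w); ring.
Qed.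

Lemma g_scal_r (u v : E14) (r : R) : g u (scal r v) = r * g u v.
Proof.
  unfold g; change (x1 (scal r v)) with (r * x1 v);
    change (x2 (scal r v)) with (r * x2 v);
    change (x3 (scal r v)) with (r * x3 v);
    change (x4 (scal r v)) with (r * x4 v); ring.
Qed.

Lemma g_sym (u v : E14) : g u v = g v u.
Proof. unfold g; ring. Qed.

(** * Calculus on an open interval *)

(** Openness is what allows an identity valid on the interval to be differentiated at each of its
    points. *)
Lemma locally_interval (a b : Rbar) (s : R) :
  Rbar_open_interval a b s -> locally s (Rbar_open_interval a b).
Proof.
  intros [H1 H2].
  apply (open_and (fun u : R => Rbar_lt a u) (fun u : R => Rbar_lt u b)).
  - apply open_Rbar_gt.
  - apply open_Rbar_lt.
  - now split.
Qed.

Lemma interval_convex (a b : Rbar) (s t u : R) :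
  Rbar_open_interval a b s -> Rbar_open_interval a b t -> s <= u <= t ->
  Rbar_open_interval a b u.
Proof.
  intros [Hs _] [_ Ht] [H1 H2]; split.
  - now apply Rbar_lt_le_trans with s.
  - now apply Rbar_le_lt_trans with t.
Qed.

Lemma constant_on_interval (a b : Rbar) (f : R -> R) :
  (forall s, Rbar_open_interval a b s -> is_derive f s 0) ->
  forall s t, Rbar_open_interval a b s -> Rbar_open_interval a b t -> f s = f t.
Proof.
  intros Hf.
  assert (H : forall s t, s < t -> Rbar_open_interval a b s ->
    Rbar_open_interval a b t -> f s = f t).
  { intros s t Hst Hs Ht.
    apply (eq_is_derive f s t); [|exact Hst].
    intros u Hu; apply Hf; now apply interval_convex with s t. }
  intros s t Hs Ht.
  destruct (Rtotal_order s t) as [Hl | [-> | Hl]]; [|reflexivity|symmetry]; auto.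
Qed.

Lemma is_derive_RInt_interval (a b : Rbar) (k : R -> R) (r s : R) :
  (forall u, Rbar_open_interval a b u -> continuous k u) ->
  Rbar_open_interval a b r -> Rbar_open_interval a b s ->
  is_derive (RInt k r) s (k s).
Proof.
  intros Hk Hr Hs.
  apply is_derive_RInt with r; [|now apply Hk].
  apply (filter_imp (Rbar_open_interval a b)); [|now apply locally_interval].
  intros t Ht; apply (@RInt_correct R_CompleteNormedModule), ex_RInt_continuous.
  intros u Hu; apply Hk.
  unfold Rmin, Rmax in Hu; destruct (Rle_dec r t).
  - now apply interval_convex with r t.
  - now apply interval_convex with t r.
Qed.

(** * Hyperbolic functions and the hyperbolic rotation system *)

Lemma is_derive_cosh (f : R -> R) (s l : R) :
  is_derive f s l -> is_derive (fun t => cosh (f t)) s (l * sinh (f s)).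
Proof.
  intros Hf; unfold cosh, sinh; auto_derive.
  - repeat split; now exists l.
  - rewrite (is_derive_unique (fun x : R => f x) _ _ Hf); field.
Qed.

Lemma is_derive_sinh (f : R -> R) (s l : R) :
  is_derive f s l -> is_derive (fun t => sinh (f t)) s (l * cosh (f s)).
Proof.
  intros Hf; unfold cosh, sinh; auto_derive.
  - repeat split; now exists l.
  - rewrite (is_derive_unique (fun x : R => f x) _ _ Hf); field.
Qed.

Lemma cosh2_sub_sinh2 (x : R) : cosh x * cosh x - sinh x * sinh x = 1.
Proof.
  unfold cosh, sinh.
  assert (H : exp x * exp (- x) = 1)
    by (rewrite <- exp_plus, Rplus_opp_r; apply exp_0).
  transitivity (exp x * exp (- x)); [field | exact H].
Qed.

Lemma hyperbolic_system (a b : Rbar) (k th f1 f2 : R -> R) :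
  Rbar_open_interval a b 0 ->
  (forall s, Rbar_open_interval a b s -> is_derive th s (k s)) ->
  (forall s, Rbar_open_interval a b s -> is_derive f1 s (k s * f2 s)) ->
  (forall s, Rbar_open_interval a b s -> is_derive f2 s (k s * f1 s)) ->
  exists A B : R, forall s, Rbar_open_interval a b s ->
    f1 s = A * cosh (th s) + B * sinh (th s).
Proof.
  intros H0 Hth H1 H2.
  (* The pair [(f1, f2)] rotated back by the hyperbolic angle [th]; both components have derivative
     zero. *)
  set (FA := fun t => f1 t * cosh (th t) - f2 t * sinh (th t)).
  set (FB := fun t => f2 t * cosh (th t) - f1 t * sinh (th t)).
  assert (HA : forall s, Rbar_open_interval a b s -> is_derive FA s 0).
  { intros s Hs; unfold FA.
    pose proof (is_derive_cosh _ _ _ (Hth s Hs)) as Hc.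
    pose proof (is_derive_sinh _ _ _ (Hth s Hs)) as Hsh.
    specialize (H1 s Hs); specialize (H2 s Hs).
    evar_last.
    - exact (is_derive_minus _ _ _ _ _ (is_derive_Rmult _ _ _ _ _ H1 Hc)
        (is_derive_Rmult _ _ _ _ _ H2 Hsh)).
    - unfold minus, plus, opp; simpl; ring. }
  assert (HB : forall s, Rbar_open_interval a b s -> is_derive FB s 0).
  { intros s Hs; unfold FB.
    pose proof (is_derive_cosh _ _ _ (Hth s Hs)) as Hc.
    pose proof (is_derive_sinh _ _ _ (Hth s Hs)) as Hsh.
    specialize (H1 s Hs); specialize (H2 s Hs).
    evar_last.
    - exact (is_derive_minus _ _ _ _ _ (is_derive_Rmult _ _ _ _ _ H2 Hc)
        (is_derive_Rmult _ _ _ _ _ H1 Hsh)).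
    - unfold minus, plus, opp; simpl; ring. }
  (* [FA] and [FB] may now be evaluated at [s] instead of 0, and rotating forward again recovers
     [f1 s] by [cosh2_sub_sinh2]. *)
  exists (FA 0), (FB 0); intros s Hs.
  rewrite (constant_on_interval a b FA HA 0 s H0 Hs),
    (constant_on_interval a b FB HB 0 s H0 Hs).
  unfold FA, FB.
  transitivity (f1 s * (cosh (th s) * cosh (th s) - sinh (th s) * sinh (th s)));
    [rewrite cosh2_sub_sinh2|]; ring.
Qed.

(** * Smoothness, and translates of curves *)

Lemma smooth_on_continuous (J : R -> Prop) (f : R -> R) (s : R) :
  smooth_on J f -> J s -> continuous f s.
Proof. intros Hf Hs; apply (ex_derive_continuous f s), (Hf 1%nat s Hs). Qed.

(** Openness of [J] enters because the sum rule for n-th derivatives asks for differentiability on a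
    neighbourhood of the point. *)
Lemma smooth_on_translate (J : R -> Prop) (f : R -> R) (c : R) :
  (forall s, J s -> locally s J) -> smooth_on J f ->
  smooth_on J (fun s => f s + c).
Proof.
  intros HJ Hf n s Hs.
  apply ex_derive_n_plus.
  - apply (filter_imp J); [|now apply HJ].
    intros t Ht k _; now apply Hf.
  - apply filter_forall; intros t k _; apply ex_derive_n_const.
Qed.

Lemma is_derive_translate (alpha : R -> E14) (p : E14) (s : R) (v : E14) :
  is_derive (fun t => plus (alpha t) p) s v <-> is_derive alpha s v.
Proof.
  assert (H : forall (f : R -> E14) q, is_derive f s v ->
    is_derive (fun t => plus (f t) q) s v).
  { intros f q Hf.
    rewrite <- (plus_zero_r v).
    apply @is_derive_plus; [exact Hf | apply @is_derive_const]. }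
  split; [|apply H].
  (* The converse is the direct implication for the translation by [opp p]. *)
  intros Hd; apply (is_derive_ext (fun t => plus (plus (alpha t) p) (opp p))).
  - intros t; rewrite <- plus_assoc, (plus_opp_r (G := E14)); apply plus_zero_r.
  - now apply H.
Qed.

Lemma unit_speed_translate (J : R -> Prop) (alpha : R -> E14) (p : E14) :
  (forall s, J s -> locally s J) -> unit_speed_spacelike_curve J alpha ->
  unit_speed_spacelike_curve J (fun s => plus (alpha s) p).
Proof.
  intros HJ [[(S1 & S2 & S3 & S4) Hsp] Hu].
  repeat split.
  - exact (smooth_on_translate J _ (x1 p) HJ S1).
  - exact (smooth_on_translate J _ (x2 p) HJ S2).
  - exact (smooth_on_translate J _ (x3 p) HJ S3).
  - exact (smooth_on_translate J _ (x4 p) HJ S4).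
  - apply (Hsp s v H), (is_derive_translate alpha p), H0.
  - apply (Hsp s v H), (is_derive_translate alpha p), H0.
  - intros s v Hs Hv; apply (Hu s v Hs), (is_derive_translate alpha p), Hv.
Qed.

Lemma frenet_frame_translate (J : R -> Prop) (alpha : R -> E14) (p : E14) (eps : R)
    (T N B1 B2 : R -> E14) (k1 k2 k3 : R -> R) :
  frenet_frame J alpha eps T N B1 B2 k1 k2 k3 ->
  frenet_frame J (fun s => plus (alpha s) p) eps T N B1 B2 k1 k2 k3.
Proof.
  intros []; constructor; trivial.
  intros s Hs; apply is_derive_translate; auto.
Qed.

(** * From a rectifying image to the curvature ratio *)

(* The principal normal of the image is [(k1 / k1') L N], where [k1'] is the first
   curvature of the frame chosen for [beta]. *)
Lemma rectifying_image_orthogonal (a b : Rbar) (alpha beta : R -> E14) (eps : R)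
    (T N B1 B2 : R -> E14) (k1 k2 k3 : R -> R) (L : E14 -> E14) (p : E14) :
  let J := Rbar_open_interval a b in
  frenet_frame J alpha eps T N B1 B2 k1 k2 k3 ->
  (forall s, J s -> k1 s <> 0) ->
  is_linear L ->
  (forall s, J s -> beta s = plus (L (alpha s)) p) ->
  rectifying J beta ->
  forall s, J s -> g (plus (L (alpha s)) p) (L (N s)) = 0.
Proof.
  intros J HF Hk1 HL Hbeta [_ (eps' & T' & N' & B1' & B2' & k1' & k2' & k3' & HF' & HN')].
  (* Both sides are the velocity of [beta], computed from its own frame and from
     [beta = L alpha + p]. *)
  assert (HT : forall s, J s -> T' s = L (T s)).
  { intros s Hs.
    apply (is_derive_E14_unique (fun t => plus (L (alpha t)) p) s).
    - apply (is_derive_ext_loc beta).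
      + apply (filter_imp J); [exact Hbeta | now apply locally_interval].
      + now apply (frenet_alpha' _ _ _ _ _ _ _ _ _ _ HF').
    - apply (is_derive_translate (fun t => L (alpha t))).
      apply is_derive_linear; [exact HL|].
      now apply (frenet_alpha' _ _ _ _ _ _ _ _ _ _ HF). }
  intros s Hs.
  (* Differentiating [T' = L T] gives the acceleration of [beta] in both frames. *)
  assert (E : scal (k1' s) (N' s) = L (scal (k1 s) (N s))).
  { apply (is_derive_E14_unique T' s).
    - now apply (frenet_T' _ _ _ _ _ _ _ _ _ _ HF').
    - apply (is_derive_ext_loc (fun t => L (T t))).
      + apply (filter_imp J); [intros t Ht; symmetry; now apply HT|].
        now apply locally_interval.
      + apply is_derive_linear; [exact HL|].
        now apply (frenet_T' _ _ _ _ _ _ _ _ _ _ HF). }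
  rewrite (linear_scal L HL) in E.
  (* After multiplication by [k1 s], the left side is [k1' s * g (beta s) (N' s)], which vanishes
     because [beta] is rectifying. *)
  apply (Rmult_eq_reg_l (k1 s)); [|now apply Hk1].
  pose proof (g_scal_r (plus (L (alpha s)) p) (L (N s)) (k1 s)) as G.
  pose proof (g_scal_r (plus (L (alpha s)) p) (N' s) (k1' s)) as G'.
  pose proof (f_equal (g (plus (L (alpha s)) p)) E) as E'.
  rewrite <- (Hbeta s Hs) in *; rewrite (HN' s Hs) in G'.
  rewrite <- G, Rmult_0_r, <- (Rmult_0_r (k1' s)), <- G'; symmetry; exact E'.
Qed.

Lemma curvature_ratio_of_orthogonal (a b : Rbar) (alpha : R -> E14) (eps : R)
    (T N B1 B2 : R -> E14) (k1 k2 k3 : R -> R) (L : E14 -> E14) (p : E14) :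
  let J := Rbar_open_interval a b in
  J 0 ->
  frenet_frame J alpha eps T N B1 B2 k1 k2 k3 ->
  (forall s, J s -> k2 s <> 0) ->
  is_linear L ->
  (forall v w, g (L v) (L w) = g v w) ->
  (forall s, J s -> g (plus (L (alpha s)) p) (L (N s)) = 0) ->
  exists A B c : R, forall s, J s ->
    k1 s * (s + c) / k2 s =
    eps * (A * cosh (RInt k3 0 s) + B * sinh (RInt k3 0 s)).
Proof.
  intros J H0 HF Hk2 HL Hg HN.
  (* The component of the image curve along the transported frame vector [L X]. Since [L] is linear
     and preserves [g], these components obey the Frenet equations with the curvatures of
     [alpha]. *)
  set (f := fun (X : R -> E14) s => g (plus (L (alpha s)) p) (L (X s))).
  assert (Hf : forall X s X', J s -> is_derive X s X' ->
    is_derive (f X) s (g (T s) (X s) + g (plus (L (alpha s)) p) (L X'))).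
  { intros X s X' Hs HX.
    rewrite <- Hg.
    apply is_derive_g.
    - apply (is_derive_translate (fun t => L (alpha t))).
      apply is_derive_linear; [exact HL|].
      now apply (frenet_alpha' _ _ _ _ _ _ _ _ _ _ HF).
    - now apply is_derive_linear. }
  (* The derivative of [f T] is [1 + k1 * f N], that is 1; the value [f T 0] becomes the constant
     [c]. *)
  assert (HfT : forall s, J s -> f T s = s + f T 0).
  { intros s Hs.
    enough (f T s - s = f T 0 - 0) by lra.
    apply (constant_on_interval a b (fun s => f T s - s)); trivial.
    intros t Ht.
    evar_last.
    - apply @is_derive_minus.
      + apply Hf; [exact Ht|]. now apply (frenet_T' _ _ _ _ _ _ _ _ _ _ HF).
      + apply @is_derive_id.
    - rewrite (linear_scal L HL), g_scal_r, HN by exact Ht.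
      rewrite (frenet_TT _ _ _ _ _ _ _ _ _ _ HF) by exact Ht.
      unfold minus, plus, opp, one; simpl; ring. }
  (* This is the derivative of the identity [f N = 0]. *)
  assert (Hf1 : forall s, J s -> k1 s * f T s = k2 s * f B1 s).
  { intros s Hs.
    pose proof (Hf N s _ Hs (frenet_N' _ _ _ _ _ _ _ _ _ _ HF s Hs)) as H.
    assert (H' : is_derive (f N) s 0).
    { apply (is_derive_ext_loc (fun _ => 0)); [|apply @is_derive_const].
      apply (filter_imp J); [|now apply locally_interval].
      intros t Ht; symmetry; now apply HN. }
    apply is_derive_unique in H; apply is_derive_unique in H'.
    rewrite H', (linear_plus L HL), !(linear_scal L HL), g_plus_r, !g_scal_r in H.
    rewrite (frenet_TN _ _ _ _ _ _ _ _ _ _ HF) in H by exact Hs.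
    unfold f; lra. }
  destruct (hyperbolic_system a b k3 (RInt k3 0) (f B1) (f B2) H0) as (A & B & HAB).
  - intros s Hs; apply is_derive_RInt_interval with a b; trivial.
    intros u Hu; apply (smooth_on_continuous J); [|exact Hu].
    apply (frenet_smooth_k3 _ _ _ _ _ _ _ _ _ _ HF).
  - intros s Hs.
    evar_last.
    + apply Hf; [exact Hs|]. now apply (frenet_B1' _ _ _ _ _ _ _ _ _ _ HF).
    + rewrite (linear_plus L HL), !(linear_scal L HL), g_plus_r, !g_scal_r.
      rewrite (frenet_TB1 _ _ _ _ _ _ _ _ _ _ HF), HN by exact Hs.
      unfold f; ring.
  - intros s Hs.
    evar_last.
    + apply Hf; [exact Hs|]. now apply (frenet_B2' _ _ _ _ _ _ _ _ _ _ HF).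
    + rewrite (linear_scal L HL), g_scal_r.
      rewrite (frenet_TB2 _ _ _ _ _ _ _ _ _ _ HF) by exact Hs.
      unfold f; ring.
  (* The factor [eps] in the witnesses cancels the one in the formula, as [eps * eps = 1]. *)
  - exists (eps * A), (eps * B), (f T 0); intros s Hs.
    rewrite <- HfT, Hf1 by exact Hs.
    transitivity (f B1 s); [field; now apply Hk2|].
    rewrite HAB by exact Hs.
    destruct (frenet_eps _ _ _ _ _ _ _ _ _ _ HF) as [-> | ->]; ring.
Qed.

(** * From the curvature ratio to a rectifying translate *)

Lemma rectifying_translate_of_curvature_ratio (a b : Rbar) (alpha : R -> E14)
    (eps : R) (T N B1 B2 : R -> E14) (k1 k2 k3 : R -> R) (A B c : R) :
  let J := Rbar_open_interval a b in
  J 0 ->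
  frenet_frame J alpha eps T N B1 B2 k1 k2 k3 ->
  (forall s, J s -> k2 s <> 0) ->
  (forall s, J s -> k1 s * (s + c) / k2 s =
    eps * (A * cosh (RInt k3 0 s) + B * sinh (RInt k3 0 s))) ->
  exists p : E14, forall s, J s -> g (plus (alpha s) p) (N s) = 0.
Proof.
  intros J H0 HF Hk2 H.
  set (th := RInt k3 0) in H.
  assert (Hth : forall s, J s -> is_derive th s (k3 s)).
  { intros s Hs; apply is_derive_RInt_interval with a b; trivial.
    intros u Hu; apply (smooth_on_continuous J); [|exact Hu].
    apply (frenet_smooth_k3 _ _ _ _ _ _ _ _ _ _ HF). }
  assert (Heps : eps * eps = 1)
    by (destruct (frenet_eps _ _ _ _ _ _ _ _ _ _ HF) as [-> | ->]; ring).
  set (h1 := fun s => A * cosh (th s) + B * sinh (th s)).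
  set (h2 := fun s => A * sinh (th s) + B * cosh (th s)).
  assert (Hh1 : forall s, J s -> is_derive h1 s (k3 s * h2 s)).
  { intros s Hs; unfold h1, h2.
    evar_last.
    - apply is_derive_Rplus; apply is_derive_scal.
      + apply is_derive_cosh, Hth, Hs.
      + apply is_derive_sinh, Hth, Hs.
    - unfold scal; simpl; unfold mult; simpl; ring. }
  assert (Hh2 : forall s, J s -> is_derive h2 s (k3 s * h1 s)).
  { intros s Hs; unfold h1, h2.
    evar_last.
    - apply is_derive_Rplus; apply is_derive_scal.
      + apply is_derive_sinh, Hth, Hs.
      + apply is_derive_cosh, Hth, Hs.
    - unfold scal; simpl; unfold mult; simpl; ring. }
  (* The position vector that a rectifying translate must have: its products with [B1] and [B2] are
     [eps * h1] and [eps * h2], and the sign before [h2] comes from [g (B2 s) (B2 s) = - eps]. *)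
  set (X := fun s => plus (scal (s + c) (T s))
    (plus (scal (h1 s) (B1 s)) (scal (- h2 s) (B2 s))) : E14).
  (* Constancy of [alpha - X] is tested on linear functionals, so that the product rule and the
     constancy criterion are needed for real functions only. *)
  assert (Hconst : forall l : E14 -> R, is_linear l -> forall s, J s ->
    l (alpha s) - l (X s) = l (alpha 0) - l (X 0)).
  { intros l Hl.
    assert (HX : forall s, l (X s) =
      (s + c) * l (T s) + (h1 s * l (B1 s) + - h2 s * l (B2 s))).
    { intros s; unfold X.
      now rewrite !(linear_plus l Hl), !(linear_scal l Hl). }
    intros s Hs; rewrite !HX.
    apply (constant_on_interval a b (fun s => l (alpha s) -
      ((s + c) * l (T s) + (h1 s * l (B1 s) + - h2 s * l (B2 s))))); trivial.
    clear s Hs; intros s Hs.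
    pose proof (is_derive_linear l _ _ _ Hl
      (frenet_alpha' _ _ _ _ _ _ _ _ _ _ HF s Hs)) as Da.
    pose proof (is_derive_linear l _ _ _ Hl
      (frenet_T' _ _ _ _ _ _ _ _ _ _ HF s Hs)) as DT.
    pose proof (is_derive_linear l _ _ _ Hl
      (frenet_B1' _ _ _ _ _ _ _ _ _ _ HF s Hs)) as DB1.
    pose proof (is_derive_linear l _ _ _ Hl
      (frenet_B2' _ _ _ _ _ _ _ _ _ _ HF s Hs)) as DB2.
    rewrite (linear_scal l Hl) in DT, DB2.
    rewrite (linear_plus l Hl), !(linear_scal l Hl) in DB1.
    specialize (Hh1 s Hs); specialize (Hh2 s Hs).
    assert (Dc : is_derive (fun t => t + c) s (1 + 0))
      by (apply is_derive_Rplus; [apply @is_derive_id | apply @is_derive_const]).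
    evar_last.
    - exact (is_derive_minus _ _ _ _ _ Da (is_derive_Rplus _ _ _ _ _
        (is_derive_Rmult _ _ _ _ _ Dc DT)
        (is_derive_Rplus _ _ _ _ _ (is_derive_Rmult _ _ _ _ _ Hh1 DB1)
          (is_derive_Rmult _ _ _ _ _ (is_derive_opp _ _ _ Hh2) DB2)))).
    - unfold minus, scal, plus, opp, mult, one, zero; simpl; unfold mult; simpl.
      (* In the derivative of [alpha - X] the terms along [T], [B1] and [B2] cancel; the curvature
         ratio removes the remaining one along [N]. *)
      assert (Hr : k1 s * (s + c) = eps * k2 s * h1 s).
      { unfold h1.
        transitivity (k1 s * (s + c) / k2 s * k2 s); [field; now apply Hk2|].
        rewrite H by exact Hs; ring. }
      transitivity ((eps * k2 s * h1 s - k1 s * (s + c)) * l (N s)); [ring|].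
      rewrite Hr; ring. }
  (* With this translation vector [alpha + p] equals [X] on the interval, and [X] has no component
     along [N]. *)
  exists (opp (minus (alpha 0) (X 0))); intros s Hs.
  replace (plus (alpha s) (opp (minus (alpha 0) (X 0)))) with (X s).
  - rewrite g_sym; unfold X; rewrite !g_plus_r, !g_scal_r, (g_sym _ (T s)).
    rewrite (frenet_TN _ _ _ _ _ _ _ _ _ _ HF), (frenet_NB1 _ _ _ _ _ _ _ _ _ _ HF),
      (frenet_NB2 _ _ _ _ _ _ _ _ _ _ HF) by exact Hs; ring.
  - assert (Heq : forall l : E14 -> R, is_linear l ->
      l (X s) = l (plus (alpha s) (opp (minus (alpha 0) (X 0))))).
    { intros l Hl; unfold minus.
      rewrite (linear_plus l Hl), (linear_opp l _ Hl), (linear_plus l Hl),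
        (linear_opp l _ Hl).
      pose proof (Hconst l Hl s Hs); unfold plus, opp; simpl; lra. }
    apply E14_eq; apply Heq;
      auto using is_linear_x1, is_linear_x2, is_linear_x3, is_linear_x4.
Qed.

Theorem theorem3p1 (a b : Rbar) (Ha : Rbar_lt a 0) (Hb : Rbar_lt 0 b)
  (alpha : R -> E14) (eps : R) (T N B1 B2 : R -> E14) (k1 k2 k3 : R -> R)
  (Halpha : unit_speed_spacelike_curve (Rbar_open_interval a b) alpha)
  (Hframe : frenet_frame (Rbar_open_interval a b) alpha eps T N B1 B2 k1 k2 k3)
  (Hk1 : forall s, Rbar_open_interval a b s -> k1 s <> 0)
  (Hk2 : forall s, Rbar_open_interval a b s -> k2 s <> 0)
  (Hk3 : forall s, Rbar_open_interval a b s -> k3 s <> 0) :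
  (exists beta : R -> E14,
     congruent (Rbar_open_interval a b) alpha beta /\
     rectifying (Rbar_open_interval a b) beta)
  <->
  (exists A B c : R, forall s, Rbar_open_interval a b s ->
     k1 s * (s + c) / k2 s =
     eps * (A * cosh (RInt k3 0 s) + B * sinh (RInt k3 0 s))).
Proof.
  assert (H0 : Rbar_open_interval a b 0) by now split.
  split.
  - intros (beta & (F & (L & p & HL & Hg & HF) & Hbeta) & Hrect).
    apply (curvature_ratio_of_orthogonal a b alpha eps T N B1 B2 k1 k2 k3 L p);
      trivial.
    apply (rectifying_image_orthogonal a b alpha beta eps T N B1 B2 k1 k2 k3);
      trivial.
    intros s Hs; rewrite Hbeta by exact Hs; apply HF.
  - intros (A & B & c & H).
    destruct (rectifying_translate_of_curvature_ratio a b alpha eps T N B1 B2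
      k1 k2 k3 A B c H0 Hframe Hk2 H) as [p Hp].
    exists (fun s => plus (alpha s) p); split.
    + exists (fun v => plus v p); split; [|reflexivity].
      (* A translation is an isometry whose linear part is the identity, and it keeps the Frenet
         frame and the curvatures. *)
      exists (fun v => v), p; split; [apply is_linear_id | now split].
    + split; [apply unit_speed_translate; [apply locally_interval | exact Halpha]|].
      exists eps, T, N, B1, B2, k1, k2, k3; split; [|exact Hp].
      now apply frenet_frame_translate.
Qed.
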